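(* Let $(X,\mathcal B,m,T)$ be a probability measure preserving system and let $f:X\to U$ be bounded and measurable. Then there exists a bounded measurable $f^*:X\to U$ such that for $m$-almost every $x\in X$, $\lim_{n\to\infty}\theta_{1/n}\big(f(T^{n-1}x)\cdots f(Tx)f(x)\big)=f^*(x)$, and $f^*\circ T=f^*$ almost everywhere. If moreover $m$ is ergodic then, almost everywhere, $f^*_{i,j}=\lambda\prod_{k=i}^{j-1}\int_X f_{k,k+1}\,dm$ for all $i\le j$, where $\lambda=\lambda(j-i)>0$ is a constant depending only on $j-i$.
   Context: $U$ is the group of $d\times d$ upper triangular real matrices with all diagonal entries equal to $1$. For $t>0$, $\theta_t:U\to U$ is the automorphism defined by $(\theta_t(u))_{i,j}=t^{j-i}u_{i,j}$ for $j\ge i$. $f_{k,k+1}$ denotes the $(k,k+1)$ entry of $f$. *)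

(* Defs.v *)
From HB Require Import structures.
From mathcomp Require Import all_boot all_order all_algebra.
From mathcomp Require Import all_classical all_reals all_analysis.
Set Implicit Arguments. Unset Strict Implicit. Unset Printing Implicit Defensive.
Import Order.TTheory GRing.Theory Num.Theory.
Import numFieldNormedType.Exports.
Local Open Scope classical_set_scope.
Local Open Scope ring_scope.

Definition in_U {R : realType} {d : nat} (A : 'M[R]_d) : Prop :=
  (forall i : 'I_d, A i i = 1) /\ (forall i j : 'I_d, (j < i)%N -> A i j = 0).

(* theta_t (u)_{i,j} = t^(j-i) u_{i,j} for j >= i (and u_{i,j} for j < i,
   where u_{i,j} = 0 anyway for u in U). *)
Definition theta {R : realType} {d : nat} (t : R) (A : 'M[R]_d) : 'M[R]_d :=
  \matrix_(i, j) (if (i <= j)%N then t ^+ (j - i) * A i j else A i j).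

Fixpoint cocycle {X : Type} {R : realType} {d : nat}
  (f : X -> 'M[R]_d) (T : X -> X) (n : nat) (x : X) : 'M[R]_d :=
  match n with
  | 0 => 1%:M
  | n'.+1 => f (iter n' T x) *m cocycle f T n' x
  end.

Definition mxnat {R : realType} {d : nat} (A : 'M[R]_d) (k l : nat) : R :=
  match @insub _ (fun k => (k < d)%N) 'I_d k, @insub _ (fun k => (k < d)%N) 'I_d l with
  | Some i, Some j => A i j
  | _, _ => 0
  end.

Definition mx_measurable {disp} {X : measurableType disp} {R : realType} {d : nat}
  (f : X -> 'M[R]_d) : Prop :=
  forall i j : 'I_d, measurable_fun setT (fun x => f x i j).

Definition mx_bounded {X : Type} {R : realType} {d : nat} (f : X -> 'M[R]_d) : Prop :=
  exists M : R, forall x i j, `|f x i j| <= M.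

Definition measure_preserving {disp} {X : measurableType disp} {R : realType}
  (P : probability X R) (T : X -> X) : Prop :=
  measurable_fun setT T /\ forall A, measurable A -> P (T @^-1` A) = P A.

Definition ergodic {disp} {X : measurableType disp} {R : realType}
  (P : probability X R) (T : X -> X) : Prop :=
  forall A, measurable A -> T @^-1` A = A -> P A = 0%E \/ P A = 1%E.

(* Main.v *)
(** Each entry of the product [f (T^(n-1) x) ... f x] is a sum over [m < n] of entries of
    [f (T^m x)] times entries of the product of length [m] that are closer to the diagonal.
    Induction on the distance to the diagonal therefore shows that the [(i, j)] entry grows
    like [n ^ (j - i)], and at this order only the superdiagonal entries of [f] contribute.
    An Abel summation replaces these by their Birkhoff limits [F k], and
    [\sum_(m < n) m ^ q ~ n ^ q.+1 / q.+1] accumulates the constant [lambda k = 1 / k!]: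
    the limit is the exponential of the matrix with superdiagonal [F].
    For Birkhoff's theorem, the limsup of the averages of a bounded [f] is invariant at every
    point, so the maximal ergodic theorem applied to [f - limsup + e] bounds its integral by
    that of [f]; the same for [- f] makes limsup and liminf agree almost everywhere. *)
Require Import Defs.
From HB Require Import structures.
From mathcomp Require Import all_boot all_order all_algebra.
From mathcomp Require Import all_classical all_reals all_analysis.
From mathcomp Require Import measurable_realfun ring.
Import Order.TTheory GRing.Theory Num.Theory.
Import numFieldNormedType.Exports.
Local Open Scope classical_set_scope.
Local Open Scope ring_scope.
Set Implicit Arguments. Unset Strict Implicit. Unset Printing Implicit Defensive.

(** * Sequences of polynomial growth *)

Lemma le_norm_cvg0 {R : realFieldType} {I : Type} {F : set_system I} {FF : Filter F}
    (s t : I -> R) :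
  (\forall x \near F, `|s x| <= t x) -> t @ F --> 0 -> s @ F --> 0.
Proof.
move=> st t0; apply/norm_cvg0P; apply: (squeeze_cvgr _ (cvg_cst 0) t0).
by apply: filterS st => x ->; rewrite normr_ge0.
Qed.

Section polynomial_growth.
Variable R : archiRealFieldType.
Implicit Types (a b s t : R^nat) (k l : R) (p q n : nat).

(* The value at [n = 0] is junk, irrelevant to limits. *)
Definition scaled q s : R^nat := fun n => s n / n%:R ^+ q.

Lemma cvg_invn : (fun n => n%:R^-1 : R) @ \oo --> (0 : R).
Proof. by rewrite -(cvg_shiftS (fun n => n%:R^-1 : R)); exact: cvg_harmonic. Qed.

Lemma cvg_succ_div : (fun n => n.+1%:R / n%:R : R) @ \oo --> (1 : R).
Proof.
have lim : (fun n => 1 + n%:R^-1) @ \oo --> (1 + 0 : R).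
  by apply: cvgD; [exact: cvg_cst | exact: cvg_invn].
move: lim; rewrite addr0; apply: cvg_trans.
apply: near_eq_cvg; near=> n.
have n0 : n%:R != 0 :> R by rewrite pnatr_eq0 -lt0n; near: n; exact: nbhs_infty_gt.
by rewrite -addn1 natrD mulrDl mul1r divff // addrC.
Unshelve. all: by end_near. Qed.

Lemma cvg_scaledM p q s t k l : scaled p s @ \oo --> k -> scaled q t @ \oo --> l ->
  scaled (p + q) (fun n => s n * t n) @ \oo --> k * l.
Proof.
move=> sk tl; have -> : scaled (p + q) (fun n => s n * t n) = scaled p s \* scaled q t.
  by apply/funext => n; rewrite /scaled /= exprD invfM mulrACA.
exact: cvgM.
Qed.

Lemma cvg0_scaled_lt p q s k : (p < q)%N ->
  scaled p s @ \oo --> k -> scaled q s @ \oo --> 0.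
Proof.
move=> pq sk; have := cvg_scaledM sk (_ : scaled (q - p) (fun=> 1) @ \oo --> 0).
rewrite mulr0 subnKC ?(ltnW pq) //; under [X in scaled q X]eq_fun do rewrite mulr1.
apply; apply: le_norm_cvg0 cvg_invn; near=> n.
have n1 : 1 <= n%:R :> R by rewrite ler1n; near: n; exact: nbhs_infty_gt.
have n0 : 0 < n%:R :> R by exact: lt_le_trans n1.
rewrite /scaled mul1r ger0_norm ?invr_ge0 ?exprn_ge0 // lef_pV2 ?posrE ?exprn_gt0 //.
by rewrite ler_eXnr // subn_gt0.
Unshelve. all: by end_near. Qed.

Lemma cvg0_scaled_bounded q a b M : (forall n, `|a n| <= M) ->
  scaled q b @ \oo --> 0 -> scaled q (fun n => a n * b n) @ \oo --> 0.
Proof.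
move=> aM /cvg_norm; rewrite normr0 => b0.
apply: (le_norm_cvg0 (t := fun n => M * `|scaled q b n|)).
  by apply: nearW => n; rewrite /scaled -mulrA normrM ler_wpM2r.
by rewrite -(mulr0 M); exact: cvgMl_tmp.
Qed.

Lemma cvg0_scaled_series q s :
  scaled q s @ \oo --> 0 -> scaled q.+1 (series s) @ \oo --> 0.
Proof.
move=> /cvg_norm; rewrite normr0 => s0; rewrite -(cvg_shiftS (scaled q.+1 (series s))).
pose t n := `|s n| / n.+1%:R ^+ q.
have t0 : t @ \oo --> 0.
  apply: le_norm_cvg0 s0; near=> n.
  have n0 : 0 < n%:R :> R by rewrite ltr0n; near: n; exact: nbhs_infty_gt.
  rewrite /t /scaled !normrM normr_id ler_wpM2l // !normfV !normrX !normr_nat.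
  by rewrite lef_pV2 ?posrE ?exprn_gt0 // lerXn2r ?nnegrE // ler_nat.
have norm_le_mean n : `|scaled q.+1 (series s) n.+1| <= arithmetic_mean t n.
  rewrite /scaled /arithmetic_mean /= normrM normfV normrX normr_nat exprS invfM mulrA.
  rewrite [_ / n.+1%:R]mulrC -mulrA ler_wpM2l ?invr_ge0 // ler_pdivrMr ?exprn_gt0 //.
  rewrite /series /= (le_trans (ler_norm_sum _ _ _)) // mulr_suml.
  rewrite !big_nat ler_sum // => i /andP[_ lein]; rewrite /t mulrAC -mulrA ler_peMr //.
  by rewrite ler_pdivlMr ?exprn_gt0 // mul1r lerXn2r ?nnegrE ?ler_nat.
by apply: le_norm_cvg0 (cesaro t0); exact: nearW.
Unshelve. all: by end_near. Qed.

Lemma natr_fact_neq0 n : n`!%:R != 0 :> R.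
Proof. by rewrite pnatr_eq0 -lt0n fact_gt0. Qed.

Lemma cvg_scaled_bin q : scaled q (fun n => 'C(n, q)%:R) @ \oo --> (q`!%:R^-1 : R).
Proof.
elim: q => [|q ih].
  by rewrite /scaled; under eq_fun do rewrite bin0 expr0 divr1; rewrite invr1; exact: cvg_cst.
have lim : (fun n => q.+1%:R^-1 * (1 - q%:R / n%:R) * scaled q (fun n => 'C(n, q)%:R) n)
    @ \oo --> (q.+1%:R^-1 * (1 - q%:R * 0) * q`!%:R^-1 : R).
  apply: cvgM ih; apply: cvgMl_tmp; apply: cvgB; first exact: cvg_cst.
  by apply: cvgMl_tmp; exact: cvg_invn.
move: lim; rewrite mulr0 subr0 mulr1 -invfM -natrM -factS; apply: cvg_trans.
apply: near_eq_cvg; near=> n.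
have n0 : n%:R != 0 :> R by rewrite pnatr_eq0 -lt0n; near: n; exact: nbhs_infty_gt.
have qn : (q <= n)%N by near: n; exact: nbhs_infty_ge.
have absorb : q.+1%:R * 'C(n, q.+1)%:R = (n%:R - q%:R) * 'C(n, q)%:R :> R.
  by rewrite -natrB // -!natrM mul_bin_left.
rewrite /scaled -[in RHS](mulKf (_ : q.+1%:R != 0) 'C(n, q.+1)%:R) // absorb exprS.
by field; rewrite expf_neq0 // n0 nat1r pnatr_eq0.
Unshelve. all: by end_near. Qed.

Lemma series_bin q n : series (fun m => 'C(m, q)%:R) n = 'C(n, q.+1)%:R :> R.
Proof.
elim: n => [|n ih]; first by rewrite /series /= big_geq.
by rewrite seriesSr ih binS natrD.
Qed.

(* Binomials rather than powers: their sums are exact by Pascal's rule. *)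
Lemma cvg0_scaled_sub_bin q s l : scaled q s @ \oo --> l ->
  scaled q (fun n => s n - l * q`!%:R * 'C(n, q)%:R) @ \oo --> 0.
Proof.
move=> sl; have -> : scaled q (fun n => s n - l * q`!%:R * 'C(n, q)%:R) =
    scaled q s \- (fun n => l * q`!%:R * scaled q (fun n => 'C(n, q)%:R) n).
  by apply/funext => n; rewrite /scaled /= mulrBl mulrA.
rewrite -[X in _ --> X](subrr l) -{3}[l](mulfK (natr_fact_neq0 q)).
by apply: cvgB => //; apply: cvgMl_tmp; exact: cvg_scaled_bin.
Qed.

Lemma cvg_scaled_series q s l :
  scaled q s @ \oo --> l -> scaled q.+1 (series s) @ \oo --> l / q.+1%:R.
Proof.
move=> /cvg0_scaled_sub_bin/cvg0_scaled_series.
set c := l * _; set r := fun n => s n - _ => r0.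
have -> : scaled q.+1 (series s) =
    scaled q.+1 (series r) \+ (fun n => c * scaled q.+1 (fun n => 'C(n, q.+1)%:R) n).
  apply/funext => n; rewrite /scaled /= mulrA -mulrDl -series_bin; congr (_ / _).
  by rewrite /series /= mulr_sumr -big_split; apply: eq_bigr => i _; rewrite /r /= subrK.
have -> : l / q.+1%:R = 0 + c / q.+1`!%:R.
  rewrite add0r /c factS natrM; field.
  by rewrite natr_fact_neq0 nat1r pnatr_eq0.
by apply: cvgD r0 _; apply: cvgMl_tmp; exact: cvg_scaled_bin.
Qed.

Lemma series_mul_bin_abel s q n : series (fun m => s m * 'C(m, q.+1)%:R) n =
  series s n * 'C(n, q.+1)%:R - series (fun m => series s m.+1 * 'C(m, q)%:R) n.
Proof.
elim: n => [|n ih]; first by rewrite /series /= !big_geq // mul0r subr0.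
by rewrite !seriesSr ih binS natrD; ring.
Qed.

Lemma cvg_scaled_series_mul_bin a k q : arithmetic_mean a @ \oo --> k ->
  scaled q.+1 (series (fun m => a m * 'C(m, q)%:R)) @ \oo --> k / q.+1`!%:R.
Proof.
move=> ak; have ak' : scaled 1 (series a) @ \oo --> k.
  by rewrite -(cvg_shiftS (scaled 1 (series a))) /scaled; under eq_fun do rewrite expr1 mulrC.
case: q => [|q].
  rewrite divr1; under [X in scaled 1 (series X)]eq_fun do rewrite bin0 mulr1.
  exact: ak'.
have aSk : scaled 1 (fun m => series a m.+1) @ \oo --> k.
  rewrite -[k]mulr1; apply: cvg_trans (cvgM ak cvg_succ_div).
  apply: near_eq_cvg; apply: nearW => n.
  by rewrite /scaled /arithmetic_mean /= [_ * series _ _]mulrC mulrA mulfVK.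
have boundary := cvg_scaledM ak' (@cvg_scaled_bin q.+1).
have inner := cvg_scaled_series (cvg_scaledM aSk (@cvg_scaled_bin q)).
have -> : k / q.+2`!%:R = k / q.+1`!%:R - k / q`!%:R / q.+2%:R.
  rewrite !factS !natrM; field.
  by rewrite natr_fact_neq0 nat1r -natrD !pnatr_eq0.
apply: cvg_trans (cvgB boundary inner); apply: near_eq_cvg; apply: nearW => n.
by rewrite /scaled /= series_mul_bin_abel mulrBl.
Qed.

Lemma cvg_scaled_series_mul a b M k l q : (forall n, `|a n| <= M) ->
  arithmetic_mean a @ \oo --> k -> scaled q b @ \oo --> l ->
  scaled q.+1 (series (fun n => a n * b n)) @ \oo --> k * l / q.+1%:R.
Proof.
move=> aM ak /cvg0_scaled_sub_bin.
set c := l * _; set r := fun n => b n - _ => /(cvg0_scaled_bounded aM)/cvg0_scaled_series ar0.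
have -> : scaled q.+1 (series (fun n => a n * b n)) =
    scaled q.+1 (series (fun n => a n * r n)) \+
    (fun n => c * scaled q.+1 (series (fun m => a m * 'C(m, q)%:R)) n).
  apply/funext => n; rewrite /scaled /= mulrA -mulrDl; congr (_ / _).
  by rewrite /series /= mulr_sumr -big_split; apply: eq_bigr => i _; rewrite /r /=; ring.
have -> : k * l / q.+1%:R = 0 + c * (k / q.+1`!%:R).
  rewrite add0r /c factS natrM; field.
  by rewrite natr_fact_neq0 nat1r pnatr_eq0.
by apply: cvgD ar0 _; apply: cvgMl_tmp; exact: cvg_scaled_series_mul_bin.
Qed.

End polynomial_growth.

(** * Upper and lower limits of bounded sequences *)

Section bounded_limn_sup_inf.
Variable R : realType.
Implicit Types (u v : R^o^nat) (c M : R).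

Lemma norm_le_bounded_fun (I : Type) (w : I -> R^o) M :
  (forall i, `|w i| <= M) -> bounded_fun w.
Proof.
by move=> wM; exists M; split=> [|r /ltW Mr i _]; [exact: num_real | exact: le_trans (wM i) Mr].
Qed.

Lemma bounded_cvg_sups u : bounded_fun u -> sups u @ \oo --> limn_sup u.
Proof.
move=> ub; rewrite limn_supE //.
by apply: cvg_sups_inf; [exact: bounded_fun_has_ubound | exact: bounded_fun_has_lbound].
Qed.

Lemma bounded_cvg_infs u : bounded_fun u -> infs u @ \oo --> limn_inf u.
Proof.
move=> ub; rewrite limn_infE //.
by apply: cvg_infs_sup; [exact: bounded_fun_has_ubound | exact: bounded_fun_has_lbound].
Qed.

Lemma bounded_limn_supN u : bounded_fun u -> limn_sup (- u) = - limn_inf u.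
Proof.
move=> ub; apply/cvg_lim => //.
by rewrite [sups _]supsN; apply: cvgN; exact: bounded_cvg_infs.
Qed.

Lemma bounded_le_sups u n : bounded_fun u -> u n <= sups u n.
Proof.
move=> ub; apply: ub_le_sup; last by exists n => /=.
exact/has_ubound_sdrop/bounded_fun_has_ubound.
Qed.

Lemma bounded_infs_le u n : bounded_fun u -> infs u n <= u n.
Proof.
move=> ub; apply: ge_inf; last by exists n => /=.
exact/has_lbound_sdrop/bounded_fun_has_lbound.
Qed.

Lemma bounded_limn_inf_le_sup u : bounded_fun u -> limn_inf u <= limn_sup u.
Proof.
move=> ub; apply: (ler_cvg_to (bounded_cvg_infs ub) (bounded_cvg_sups ub)).
by apply: nearW => n; exact: le_trans (bounded_infs_le n ub) (bounded_le_sups n ub).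
Qed.

Lemma bounded_cvg_limn_sup u : bounded_fun u -> limn_inf u = limn_sup u ->
  u @ \oo --> limn_sup u.
Proof.
move=> ub infsup; have infs_cvg := bounded_cvg_infs ub; rewrite infsup in infs_cvg.
apply: squeeze_cvgr infs_cvg (bounded_cvg_sups ub).
by apply: nearW => n; rewrite bounded_infs_le ?bounded_le_sups.
Qed.

Lemma limn_sup_le u c : bounded_fun u -> (forall n, u n <= c) -> limn_sup u <= c.
Proof.
move=> ub uc; apply: (cvgr_to_le (bounded_cvg_sups ub)); apply: nearW => n.
by apply: ge_sup; [exists (u n); exists n => /= | move=> _ [k _ <-]; exact: uc].
Qed.

Lemma le_limn_sup u c : bounded_fun u -> (forall n, c <= u n) -> c <= limn_sup u.
Proof.
move=> ub uc; apply: (cvgr_to_ge (bounded_cvg_sups ub)); apply: nearW => n.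
exact: le_trans (uc n) (bounded_le_sups n ub).
Qed.

Lemma norm_limn_sup_le u M : (forall n, `|u n| <= M) -> `|limn_sup u| <= M.
Proof.
move=> uM; have ub := norm_le_bounded_fun uM; rewrite ler_norml.
rewrite limn_sup_le ?le_limn_sup // => n; have := uM n; rewrite ler_norml => /andP[//].
Qed.

Lemma lt_limn_sup u c : bounded_fun u -> c < limn_sup u -> exists n, c < u n.
Proof.
move=> ub; apply: contraPP => /forallNP uc; apply/negP; rewrite -leNgt.
by apply: limn_sup_le => // n; rewrite leNgt; exact/negP/uc.
Qed.

Lemma limn_sup_eq_cvg0 u v : bounded_fun u -> bounded_fun v ->
  (u \- v) @ \oo --> 0 -> limn_sup u = limn_sup v.
Proof.
have limn_sup_mono w z : bounded_fun w -> bounded_fun z ->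
    (w \- z) @ \oo --> 0 -> limn_sup w <= limn_sup z.
  move=> wb zb wz; have := le_limn_supD zb (bounded_funD wb (bounded_funN zb)).
  rewrite (cvg_limn_inf_sup wz).2 addr0; congr (limn_sup _ <= _).
  by apply/funext => n /=; rewrite addrC subrK.
move=> ub vb uv; apply/eqP; rewrite eq_le !limn_sup_mono // -oppr0.
rewrite (_ : v \- u = - (u \- v)); first exact: cvgN.
by apply/funext => n; rewrite /= opprB.
Qed.

End bounded_limn_sup_inf.

(** * Birkhoff's ergodic theorem for bounded functions *)

Lemma measurable_set_gt {disp} {X : measurableType disp} {R : realType} (g : X -> R) c :
  measurable_fun setT g -> measurable [set x | c < g x].
Proof.
move=> /(measurable_fun_ltr (measurable_cst c))/(_ measurableT [set true]).
by rewrite setTI; exact.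
Qed.

Lemma RintegralN {disp} {X : measurableType disp} {R : realType}
    (mu : {measure set X -> \bar R}) (D : set X) (f : X -> R) :
  measurable D -> mu.-integrable D (EFin \o f) ->
  \int[mu]_(x in D) (- f x) = - \int[mu]_(x in D) f x.
Proof.
move=> mD intf; rewrite -mulN1r -RintegralZl //.
by apply: eq_Rintegral => x _; rewrite mulN1r.
Qed.

Lemma integrable_patch {disp} {X : measurableType disp} {R : realType}
    (mu : {measure set X -> \bar R}) (A : set X) (f : X -> R) :
  measurable A -> mu.-integrable setT (EFin \o f) -> mu.-integrable setT (EFin \o (f \_ A)).
Proof.
move=> mA intf; rewrite -restrict_EFin; apply: (integrable_mkcond _ mA).1.
exact: integrableS intf.
Qed.

Lemma ae_eq_Rintegral_le {disp} {X : measurableType disp} {R : realType}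
    (mu : {measure set X -> \bar R}) (f g : X -> R) :
  mu.-integrable setT (EFin \o f) -> mu.-integrable setT (EFin \o g) ->
  {ae mu, forall x, f x <= g x} -> \int[mu]_x g x <= \int[mu]_x f x ->
  {ae mu, forall x, f x = g x}.
Proof.
move=> intf intg fg Igf; have intB := integrableB measurableT intg intf.
have mB := measurable_int mu intB.
have norm_diff : (\int[mu]_x `|((EFin \o g) \- (EFin \o f)) x| =
    \int[mu]_x ((EFin \o g) \- (EFin \o f)) x)%E.
  apply: ae_eq_integral => //; first exact: measurableT_comp.
  by apply: filterS fg => x fgx _; rewrite /= ger0_norm ?subr_ge0.
have : (\int[mu]_x `|((EFin \o g) \- (EFin \o f)) x|)%E = 0%E.
  apply/eqP; rewrite eq_le integral_ge0 // andbT norm_diff integralB //.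
  rewrite leeBlDr ?add0e; last exact: integrable_fin_num.
  by rewrite -lee_fin !fineK in Igf => //; exact: integrable_fin_num.
move=> /(ae_eq_integral_abs mu measurableT mB).
by apply: filterS => x /(_ I) [] /eqP; rewrite subr_eq0 => /eqP.
Qed.

Section measure_preserving_map.
Context {disp : measure_display} {X : measurableType disp} {R : realType}.
Variables (P : probability X R) (T : X -> X).
Hypothesis mpT : measure_preserving P T.
Implicit Types f g : X -> R.

Local Notation Rintegrable f := (P.-integrable setT (EFin \o f)).

Lemma Rintegral_cst_probability c : \int[P]_x c = c.
Proof.
rewrite Rintegral_cst // -[RHS]mulr1 -[1]/(fine 1%:E); congr (_ * fine _).
exact: probability_setT.
Qed.

Lemma integrable_comp f : Rintegrable f -> Rintegrable (f \o T).
Proof.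
have [mT PT] := mpT; move=> /integrableP[mf intf]; apply/integrableP.
split; first exact: measurableT_comp mf mT.
rewrite -(preimage_setT T) -(ge0_integral_pushforward mT P (f := abse \o (EFin \o f))) //.
- by move: intf; congr (_ < _)%E; apply: eq_measure_integral => A mA _; exact/esym/PT.
- exact: measurableT_comp.
- by move=> x _; exact: abse_ge0.
Qed.

Lemma Rintegral_comp f : Rintegrable f -> \int[P]_x f (T x) = \int[P]_x f x.
Proof.
have [mT PT] := mpT; move=> intf; congr fine.
rewrite -(@integral_pushforward _ _ _ _ _ _ mT P setT (EFin \o f)) //.
- by apply: eq_measure_integral => A mA _; exact: PT.
- exact: measurable_int intf.
- exact: integrable_comp.
Qed.

Definition along_orbit f x : R^nat := fun n => f (iter n T x).

Definition birkhoff_sum f x : R^nat := series (along_orbit f x).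

Definition birkhoff_mean f x : R^nat := arithmetic_mean (along_orbit f x).

Lemma birkhoff_sumS f x n : birkhoff_sum f x n.+1 = f x + birkhoff_sum f (T x) n.
Proof.
rewrite /birkhoff_sum /series /= big_nat_recl //=; congr (_ + _).
by apply: eq_bigr => i _; rewrite /along_orbit iterSr.
Qed.

(* The maximum of [birkhoff_sum f x n] over [n <= N]. *)
Fixpoint max_birkhoff_sum f (N : nat) : X -> R :=
  if N is N'.+1 then (f \+ (max_birkhoff_sum f N' \o T))^\+ else cst 0.

Lemma max_birkhoff_sum_ge0 f N x : 0 <= max_birkhoff_sum f N x.
Proof. by case: N => [|N] /=; last exact: funrpos_ge0. Qed.

Lemma le_max_birkhoff_sumS f N x : max_birkhoff_sum f N x <= max_birkhoff_sum f N.+1 x.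
Proof.
elim: N x => [|N ih] x; first exact: max_birkhoff_sum_ge0.
rewrite [leLHS]/= [leRHS]/= /funrpos ge_max !le_max lexx orbT andbT.
by rewrite lerD2l ih.
Qed.

Lemma birkhoff_sum_le_max f n N x : (n <= N)%N -> birkhoff_sum f x n <= max_birkhoff_sum f N x.
Proof.
elim: N n x => [|N ih] [|n] x //.
- by rewrite /birkhoff_sum /series /= big_geq.
- by rewrite {1}/birkhoff_sum /series /= big_geq // funrpos_ge0.
- by move=> nN; rewrite birkhoff_sumS le_max lerD2l ih.
Qed.

Lemma integrable_max_birkhoff_sum f N : Rintegrable f -> Rintegrable (max_birkhoff_sum f N).
Proof.
move=> intf; elim: N => [|N ih]; first exact: integrable0.
by apply: integrable_funrpos => //; exact: (integrableD measurableT intf (integrable_comp ih)).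
Qed.

Lemma measurable_max_birkhoff_sum_gt0 f N : Rintegrable f ->
  measurable [set x | 0 < max_birkhoff_sum f N x].
Proof.
move=> /(integrable_max_birkhoff_sum N)/(measurable_int P)/measurable_EFinP mM.
exact: measurable_set_gt.
Qed.

Lemma max_birkhoff_sum_drift f N x :
  max_birkhoff_sum f N x - max_birkhoff_sum f N (T x) <=
  (f \_ [set y | 0 < max_birkhoff_sum f N y]) x.
Proof.
rewrite patchE; case: ifPn => [/set_mem|/negP Mx]; last first.
  rewrite subr_le0 (le_trans _ (max_birkhoff_sum_ge0 f N _)) // leNgt.
  by apply/negP => /mem_set.
case: N => [|N] /=; first by rewrite ltxx.
rewrite {1 2}/funrpos lt_max ltxx orbF => Mx.
rewrite (max_l (ltW Mx)) /= lerBlDr lerD2l.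
exact: (le_max_birkhoff_sumS f N (T x)).
Qed.

(* Garsia: where the maximum [M] is positive, [f >= M - M \o T], whose integral vanishes. *)
Lemma maximal_ergodic f N : Rintegrable f ->
  0 <= \int[P]_(x in [set x | 0 < max_birkhoff_sum f N x]) f x.
Proof.
move=> intf; have intM := integrable_max_birkhoff_sum N intf.
have mpos := measurable_max_birkhoff_sum_gt0 N intf.
have intMT := integrable_comp intM.
have drift0 : \int[P]_x (max_birkhoff_sum f N x - max_birkhoff_sum f N (T x)) = 0.
  by rewrite RintegralB // Rintegral_comp // subrr.
rewrite Rintegral_mkcond -[leLHS]drift0; apply: le_Rintegral => //.
- exact: (integrableB measurableT intM intMT).
- exact: integrable_patch.
- by move=> x _; exact: max_birkhoff_sum_drift.
Qed.

Lemma Rintegral_ge0_birkhoff_sum_gt0 f : Rintegrable f ->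
  (forall x, exists n, 0 < birkhoff_sum f x n) -> 0 <= \int[P]_x f x.
Proof.
move=> intf sum_gt0; pose E N := [set x | 0 < max_birkhoff_sum f N x].
have intE N : Rintegrable (f \_ (E N)).
  by apply: integrable_patch => //; exact: measurable_max_birkhoff_sum_gt0.
have [] := @dominated_convergence _ _ _ P setT measurableT
  (fun N => EFin \o (f \_ (E N))) (EFin \o f) (EFin \o (Num.norm \o f)).
- by move=> N; exact: measurable_int (intE N).
- exact: measurable_int intf.
- apply: aeW => x _; have [n sum_n] := sum_gt0 x.
  apply: cvg_near_cst; near=> N.
  rewrite /= patchE mem_set //; apply: lt_le_trans sum_n (birkhoff_sum_le_max _ _ _).
  by near: N; exact: nbhs_infty_ge.
- exact: integrable_norm.
- apply: aeW => x N _; rewrite /= lee_fin patchE.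
  by case: ifP => _; rewrite ?normr0.
move=> _ _ lim; rewrite fine_ge0 // -(cvg_lim _ lim) //.
apply: lime_ge; first by apply/cvg_ex; eexists; exact: lim.
apply: nearW => N; have := maximal_ergodic N intf.
by rewrite Rintegral_mkcond -lee_fin fineK //; exact: (integrable_fin_num measurableT (intE N)).
Unshelve. all: by end_near. Qed.

Lemma invariant_iter g n x : (forall y, g (T y) = g y) -> g (iter n T x) = g x.
Proof. by move=> gT; elim: n => //= n; rewrite gT. Qed.

Lemma Rintegral_le_birkhoff_mean f g : Rintegrable f -> Rintegrable g ->
  (forall x, g (T x) = g x) -> (forall x, exists n, g x < birkhoff_mean f x n) ->
  \int[P]_x g x <= \int[P]_x f x.
Proof.
move=> intf intg gT g_lt; rewrite -subr_ge0 -RintegralB //.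
apply: Rintegral_ge0_birkhoff_sum_gt0; first exact: (integrableB measurableT intf intg).
move=> x; have [n g_lt_n] := g_lt x; exists n.+1.
have -> : birkhoff_sum (fun y => f y - g y) x n.+1 =
    n.+1%:R * (birkhoff_mean f x n - g x).
  rewrite mulrBr /birkhoff_mean /arithmetic_mean /= mulVKf // /birkhoff_sum /series.
  rewrite /along_orbit /= sumrB; congr (_ - _).
  under eq_bigr do rewrite invariant_iter //.
  by rewrite sumr_const_nat subn0 mulr_natl.
by rewrite mulr_gt0 // subr_gt0.
Qed.

Definition bounded_measurable f : Prop :=
  measurable_fun setT f /\ exists M : R, forall x, `|f x| <= M.

Lemma bounded_measurable_integrable f : bounded_measurable f -> Rintegrable f.
Proof.
move=> [mf [M fM]]; apply: measurable_bounded_integrable => //.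
  exact: le_lt_trans (probability_le1 P measurableT) (ltry _).
exact: norm_le_bounded_fun fM.
Qed.

Lemma bounded_measurableN f : bounded_measurable f -> bounded_measurable (fun x => - f x).
Proof.
by move=> [mf [M fM]]; split; [exact: measurableT_comp | exists M => x; rewrite normrN].
Qed.

Definition birkhoff_limsup f x : R := limn_sup (birkhoff_mean f x).

Definition birkhoff_liminf f x : R := limn_inf (birkhoff_mean f x).

Lemma norm_birkhoff_mean_le f M x n : (forall y, `|f y| <= M) -> `|birkhoff_mean f x n| <= M.
Proof.
move=> fM; rewrite /birkhoff_mean /arithmetic_mean /= normrM normfV normr_nat.
rewrite ler_pdivrMl // (le_trans (ler_norm_sum _ _ _)) //.
rewrite mulr_natl -[n.+1]subn0 -sumr_const_nat.
by apply: ler_sum => i _; exact: fM.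
Qed.

Lemma bounded_birkhoff_mean f x : bounded_measurable f ->
  bounded_fun (birkhoff_mean f x : R^o^nat).
Proof. by move=> [_ [M fM]]; apply: norm_le_bounded_fun => n; exact: norm_birkhoff_mean_le. Qed.

Lemma measurable_birkhoff_mean f n : measurable_fun setT f ->
  measurable_fun setT (birkhoff_mean f ^~ n).
Proof.
move=> mf; apply: measurable_funM; first exact: measurable_cst.
apply: measurable_sum => i; apply: measurableT_comp => //.
elim: i => [|i ih]; first exact: measurable_id.
exact: measurableT_comp mpT.1 ih.
Qed.

Lemma norm_birkhoff_limsup_le f M x : (forall y, `|f y| <= M) -> `|birkhoff_limsup f x| <= M.
Proof. by move=> fM; apply: norm_limn_sup_le => n; exact: norm_birkhoff_mean_le. Qed.

Lemma bounded_measurable_birkhoff_limsup f :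
  bounded_measurable f -> bounded_measurable (birkhoff_limsup f).
Proof.
move=> bf; have [mf [M fM]] := bf; split; last by exists M => x; exact: norm_birkhoff_limsup_le.
apply: measurable_fun_limn_sup => [x _|x _|n]; last exact: measurable_birkhoff_mean.
  exact/bounded_fun_has_ubound/bounded_birkhoff_mean.
exact/bounded_fun_has_lbound/bounded_birkhoff_mean.
Qed.

Lemma birkhoff_limsup_invariant f x : bounded_measurable f ->
  birkhoff_limsup f (T x) = birkhoff_limsup f x.
Proof.
move=> bf; have [_ [M fM]] := bf.
apply: limn_sup_eq_cvg0; try exact: bounded_birkhoff_mean.
have lim : (fun n => (M + M) * harmonic n) @ \oo --> (0 : R).
  by rewrite -[0](mulr0 (M + M)); apply: cvgMl_tmp; exact: cvg_harmonic.
apply: le_norm_cvg0 lim; apply: nearW => n.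
have telescope : birkhoff_sum f (T x) n.+1 - birkhoff_sum f x n.+1 = f (iter n.+1 T x) - f x.
  by rewrite [birkhoff_sum f x _]birkhoff_sumS /birkhoff_sum seriesSr /along_orbit -iterSr; ring.
rewrite /birkhoff_mean /arithmetic_mean /= -mulrBr telescope normrM mulrC.
by rewrite normfV normr_nat ler_wpM2r // (le_trans (ler_normB _ _)) ?lerD.
Qed.

Lemma Rintegral_birkhoff_limsup_le f : bounded_measurable f ->
  \int[P]_x birkhoff_limsup f x <= \int[P]_x f x.
Proof.
move=> bf; have intf := bounded_measurable_integrable bf.
have intF := bounded_measurable_integrable (bounded_measurable_birkhoff_limsup bf).
apply/ler_addgt0Pr => e e0.
have inte := finite_measure_integrable_cst P e measurableT.
have : \int[P]_x (birkhoff_limsup f x - e) <= \int[P]_x f x.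
  apply: Rintegral_le_birkhoff_mean => //.
  - exact: (integrableB measurableT intF inte).
  - by move=> x; rewrite birkhoff_limsup_invariant.
  - move=> x; apply: lt_limn_sup; first exact: bounded_birkhoff_mean.
    by rewrite ltrBlDr ltrDl.
by rewrite RintegralB // Rintegral_cst_probability lerBlDr.
Qed.

Lemma birkhoff_meanN f x : birkhoff_mean (fun y => - f y) x = - birkhoff_mean f x.
Proof.
apply/funext => n; rewrite /birkhoff_mean /arithmetic_mean /= -mulrN; congr (_ * _).
by rewrite /series /= sumrN.
Qed.

Lemma birkhoff_limsupN f : bounded_measurable f ->
  birkhoff_limsup (fun x => - f x) = (fun x => - birkhoff_liminf f x).
Proof.
move=> bf; apply/funext => x; rewrite /birkhoff_limsup birkhoff_meanN.
by apply: bounded_limn_supN; exact: bounded_birkhoff_mean.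
Qed.

Lemma bounded_measurable_birkhoff_liminf f :
  bounded_measurable f -> bounded_measurable (birkhoff_liminf f).
Proof.
move=> bf; have := bounded_measurable_birkhoff_limsup (bounded_measurableN bf).
rewrite birkhoff_limsupN // => /bounded_measurableN.
by under eq_fun do rewrite opprK.
Qed.

Lemma Rintegral_birkhoff_liminf_ge f : bounded_measurable f ->
  \int[P]_x f x <= \int[P]_x birkhoff_liminf f x.
Proof.
move=> bf; have := Rintegral_birkhoff_limsup_le (bounded_measurableN bf).
rewrite birkhoff_limsupN // !RintegralN ?lerN2 //; apply: bounded_measurable_integrable => //.
exact: bounded_measurable_birkhoff_liminf.
Qed.

Lemma ae_birkhoff_liminf_eq_limsup f : bounded_measurable f ->
  {ae P, forall x, birkhoff_liminf f x = birkhoff_limsup f x}.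
Proof.
move=> bf; apply: ae_eq_Rintegral_le.
- exact/bounded_measurable_integrable/bounded_measurable_birkhoff_liminf.
- exact/bounded_measurable_integrable/bounded_measurable_birkhoff_limsup.
- by apply: aeW => x; apply: bounded_limn_inf_le_sup; exact: bounded_birkhoff_mean.
- exact: le_trans (Rintegral_birkhoff_limsup_le bf) (Rintegral_birkhoff_liminf_ge bf).
Qed.

Lemma cvg_birkhoff_mean f : bounded_measurable f ->
  {ae P, forall x, birkhoff_mean f x @ \oo --> birkhoff_limsup f x}.
Proof.
move=> bf; apply: filterS (ae_birkhoff_liminf_eq_limsup bf) => x.
by apply: bounded_cvg_limn_sup; exact: bounded_birkhoff_mean.
Qed.

Lemma Rintegral_birkhoff_limsup f : bounded_measurable f ->
  \int[P]_x birkhoff_limsup f x = \int[P]_x f x.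
Proof.
move=> bf; apply/eqP; rewrite eq_le Rintegral_birkhoff_limsup_le //=.
apply: le_trans (Rintegral_birkhoff_liminf_ge bf) _; apply: le_Rintegral => //.
- exact/bounded_measurable_integrable/bounded_measurable_birkhoff_liminf.
- exact/bounded_measurable_integrable/bounded_measurable_birkhoff_limsup.
- by move=> x _; apply: bounded_limn_inf_le_sup; exact: bounded_birkhoff_mean.
Qed.

Lemma ergodic_invariant_ae_cst g : ergodic P T -> Rintegrable g ->
  (forall x, g (T x) = g x) -> {ae P, forall x, g x = \int[P]_y g y}.
Proof.
move=> ergT intg gT; set c := \int[P]_y g y.
have intc := finite_measure_integrable_cst P c measurableT.
pose A := [set x | c < g x].
have mg : measurable_fun setT g by exact/measurable_EFinP/(measurable_int P).
have mA : measurable A by exact: measurable_set_gt.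
have TA : T @^-1` A = A by apply/funext => x; rewrite /A /= gT.
have [PA|PA] := ergT A mA TA.
  apply: (ae_eq_Rintegral_le intg intc); last by rewrite Rintegral_cst_probability.
  by exists A; split => // x /= /negP; rewrite -ltNge.
have : {ae P, forall x, cst c x = g x}.
  apply: (ae_eq_Rintegral_le intc intg); last by rewrite Rintegral_cst_probability.
  have PAC : P (~` A) = 0%E by rewrite probability_setC // PA subee.
  exists (~` A); split => //; first exact: measurableC.
  by move=> x /= gc /ltW.
by apply: filterS => x /esym.
Qed.

Lemma ergodic_birkhoff_limsup f : ergodic P T -> bounded_measurable f ->
  {ae P, forall x, birkhoff_limsup f x = \int[P]_y f y}.
Proof.
move=> ergT bf; rewrite -Rintegral_birkhoff_limsup //; apply: ergodic_invariant_ae_cst => //.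
  exact/bounded_measurable_integrable/bounded_measurable_birkhoff_limsup.
by move=> x; exact: birkhoff_limsup_invariant.
Qed.

End measure_preserving_map.

(** * Products of unipotent matrices *)

Lemma cvg_mx {I : Type} {F : set_system I} {FF : Filter F} (T : topologicalType) m n
    (A : I -> 'M[T]_(m, n)) (B : 'M[T]_(m, n)) :
  (forall i j, A x i j @[x --> F] --> B i j) -> A @ F --> B.
Proof.
move=> AB V [Q nQ QV]; have : \forall x \near F, forall i j, Q i j (A x i j).
  by apply: filter_forall => i; apply: filter_forall => j; apply: AB; exact: nQ.
by apply: filterS => x; exact: QV.
Qed.

Section unipotent.
Variables (R : realType) (d : nat).
Implicit Types A B : 'M[R]_d.

Lemma in_U1 : in_U (1%:M : 'M[R]_d).
Proof.
split=> [i|i j ji]; rewrite mxE ?eqxx //.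
by case: eqVneq ji => // ->; rewrite ltnn.
Qed.

Lemma in_U_mulmx A B : in_U A -> in_U B -> in_U (A *m B).
Proof.
move=> [A1 A0] [B1 B0]; split=> [i|i j ji]; rewrite mxE.
  rewrite (bigD1 i) //= A1 B1 mulr1 big1 ?addr0 // => l li.
  have [/A0 ->|/B0 ->|/val_inj il] := ltngtP l i; rewrite ?mul0r ?mulr0 //.
  by rewrite il eqxx in li.
rewrite big1 // => l _; case: (ltnP l i) => [/A0 ->|il]; first by rewrite mul0r.
by rewrite (B0 l j) ?mulr0 // (leq_trans ji).
Qed.

Lemma mxnatE A (i j : 'I_d) : mxnat A i j = A i j.
Proof. by rewrite /mxnat !valK. Qed.

Lemma norm_mxnat_le A M k l : (forall i j, `|A i j| <= M) -> `|mxnat A k l| <= `|M|.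
Proof.
move=> AM; rewrite /mxnat; case: insubP => [i _ _|_]; last by rewrite normr0.
case: insubP => [j _ _|_]; last by rewrite normr0.
exact: le_trans (AM i j) (ler_norm M).
Qed.

Lemma measurable_mxnat {disp} {X : measurableType disp} (f : X -> 'M[R]_d) k l :
  mx_measurable f -> measurable_fun setT (fun x => mxnat (f x) k l).
Proof.
move=> mf; rewrite /mxnat; case: insubP => [i _ _|_]; last exact: measurable_cst.
by case: insubP => [j _ _|_]; [exact: mf | exact: measurable_cst].
Qed.

Fixpoint left_prod (A : nat -> 'M[R]_d) n : 'M[R]_d :=
  if n is n'.+1 then A n' *m left_prod A n' else 1%:M.

Lemma cocycle_left_prod (X : Type) (f : X -> 'M[R]_d) (T : X -> X) n x :
  cocycle f T n x = left_prod (fun m => f (iter m T x)) n.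
Proof. by elim: n => //= n ->. Qed.

Lemma in_U_left_prod (A : nat -> 'M[R]_d) n : (forall m, in_U (A m)) -> in_U (left_prod A n).
Proof. by move=> AU; elim: n => [|n ih]; [exact: in_U1 | exact: in_U_mulmx]. Qed.

(* The exponential of the matrix with superdiagonal entries [c k] and zeros elsewhere. *)
Definition exp_superdiag (c : nat -> R) : 'M[R]_d :=
  \matrix_(i, j) if (i <= j)%N then (j - i)`!%:R^-1 * \prod_(i <= k < j) c k else 0.

Lemma in_U_exp_superdiag c : in_U (exp_superdiag c).
Proof.
split=> [i|i j ji]; rewrite mxE; last by rewrite leqNgt ji.
by rewrite leqnn subnn invr1 big_geq // mulr1.
Qed.

Lemma norm_exp_superdiag_le c M i j :
  (forall k, `|c k| <= M) -> `|exp_superdiag c i j| <= (1 + M) ^+ d.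
Proof.
move=> cM; have M0 : 0 <= M by exact: le_trans (cM 0).
rewrite mxE; case: ifP => _; last by rewrite normr0 exprn_ge0 // addr_ge0.
rewrite normrM -[leRHS]mul1r ler_pM //.
  by rewrite normfV normr_nat invf_le1 ?ltr0n ?ler1n ?fact_gt0.
rewrite normr_prod (@le_trans _ _ (\prod_(i <= k < j) (1 + M))) //.
  by apply: ler_prod => k _; rewrite normr_ge0 (le_trans (cM k)) // lerDr.
rewrite prodr_const_nat ler_weXn2l ?lerDl //.
by rewrite (leq_trans (leq_subr _ _)) // ltnW.
Qed.

Lemma measurable_exp_superdiag {disp} {X : measurableType disp} (c : nat -> X -> R) :
  (forall k, measurable_fun setT (c k)) -> mx_measurable (fun x => exp_superdiag (c ^~ x)).
Proof.
move=> mc i j; under eq_fun do rewrite mxE.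
case: leqP => _; last exact: measurable_cst.
apply: measurable_funM; first exact: measurable_cst.
by apply: measurable_prod => k _; exact: mc.
Qed.

Section left_prod_growth.
Variables (A : nat -> 'M[R]_d) (M : R) (c : nat -> R).
Hypothesis AU : forall n, in_U (A n).
Hypothesis A_bounded : forall n i j, `|A n i j| <= M.
Hypothesis A_mean : forall k, (k.+1 < d)%N ->
  arithmetic_mean (fun n => mxnat (A n) k k.+1) @ \oo --> c k.

Lemma left_prod_entryE n (i j : 'I_d) : i != j ->
  left_prod A n i j = \sum_(l | l != i) series (fun m => A m i l * left_prod A m l j) n.
Proof.
move=> ij; elim: n => [|n ih].
  by rewrite mxE (negPf ij) big1 // => l _; rewrite /series /= big_geq.
rewrite /= mxE (bigD1 i) //= (AU n).1 mul1r ih -big_split.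
by apply: eq_bigr => l _; rewrite seriesSr.
Qed.

Lemma cvg0_scaled_off_superdiag p (i l j : 'I_d) : j = (i + p.+1)%N :> nat ->
  l != i -> l != i.+1 :> nat ->
  ((i.+1 < l <= j)%N ->
    exists s : R, scaled (j - l) (fun n => left_prod A n l j) @ \oo --> s) ->
  scaled p.+1 (series (fun n => A n i l * left_prod A n l j)) @ \oo --> (0 : R).
Proof.
move=> ij li li1 lj_cvg; apply: cvg0_scaled_series.
have [il|il|il] := ltngtP l i; last by rewrite -val_eqE /= il eqxx in li.
  rewrite /scaled; under eq_fun do rewrite (AU _).2 // !mul0r.
  exact: cvg_cst.
have [jl|lj] := ltnP j l.
  rewrite /scaled; under eq_fun do rewrite (in_U_left_prod _ AU).2 // mulr0 mul0r.
  exact: cvg_cst.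
have i1l : (i.+1 < l)%N by rewrite ltn_neqAle eq_sym li1.
apply: cvg0_scaled_bounded => [n|]; first exact: A_bounded.
have [|s lj_s] := lj_cvg; first by rewrite i1l.
by apply: cvg0_scaled_lt lj_s; rewrite ltn_subLR // ij addnS -addSn ltn_add2r.
Qed.

Lemma cvg_left_prod_entry p (i j : 'I_d) : j = (i + p)%N :> nat ->
  scaled p (fun n => left_prod A n i j) @ \oo -->
    (p`!%:R^-1 * \prod_(i <= k < j) c k : R).
Proof.
elim/ltn_ind: p i j => -[_|p ih] i j ij.
  have -> : j = i by apply: val_inj; rewrite /= ij addn0.
  rewrite big_geq // mulr1 invr1 /scaled.
  under eq_fun do rewrite (in_U_left_prod _ AU).1 divr1.
  exact: cvg_cst.
have i1d : (i.+1 < d)%N by rewrite (leq_ltn_trans _ (ltn_ord j)) // ij addnS ltnS leq_addr.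
pose i1 := Ordinal i1d; set entry_lim : R := p.+1`!%:R^-1 * \prod_(i <= k < j) c k.
have superdiag_term :
    scaled p.+1 (series (fun n => A n i i1 * left_prod A n i1 j)) @ \oo --> entry_lim.
  have -> : entry_lim = c i * (p`!%:R^-1 * \prod_(i1 <= k < j) c k) / p.+1%:R.
    rewrite /entry_lim factS natrM invfM (big_ltn (m := i)) /=; first by ring.
    by rewrite ij addnS ltnS leq_addr.
  apply: (@cvg_scaled_series_mul _ _ _ M) => [n||]; first exact: A_bounded.
    by under [X in arithmetic_mean X]eq_fun do rewrite -mxnatE; exact: A_mean.
  by apply: ih => //=; rewrite ij addSnnS.
have -> : scaled p.+1 (fun n => left_prod A n i j) = fun n =>
    \sum_(l | l != i) scaled p.+1 (series (fun n => A n i l * left_prod A n l j)) n.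
  apply/funext => n; rewrite /scaled left_prod_entryE ?mulr_suml //.
  by rewrite eq_sym -val_eqE /= ij -[X in _ != X]addn0 eqn_add2l.
have -> : entry_lim = \sum_(l | l != i) (if l == i1 then entry_lim else 0).
  rewrite -big_mkcondr (big_pred1 i1) // => l /=.
  by have [->|_] := eqVneq l i1; rewrite ?andbF // andbT -val_eqE /= gtn_eqF.
apply: cvg_big => [|l li]; first exact: add_continuous.
case: eqVneq => [->|li1] //; apply: cvg0_scaled_off_superdiag => // /andP[i1l lj].
exists ((j - l)`!%:R^-1 * \prod_(l <= k < j) c k); apply: ih; last by rewrite subnKC.
by rewrite ltnS leq_subLR ij addnS -addSn leq_add2r ltnW.
Qed.

Lemma cvg_theta_left_prod :
  (fun n => theta n%:R^-1 (left_prod A n)) @ \oo --> exp_superdiag c.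
Proof.
apply: cvg_mx => i j; rewrite mxE.
case: (leqP i j) => [ij|ji].
  under eq_fun do rewrite mxE ij exprVn mulrC.
  exact: cvg_left_prod_entry (esym (subnKC ij)).
under eq_fun do rewrite mxE leqNgt ji (in_U_left_prod _ AU).2 //.
exact: cvg_cst.
Qed.

End left_prod_growth.

End unipotent.

Theorem theorem1p6 (R : realType) :
  exists lambda : nat -> R, (forall k, 0 < lambda k) /\
  forall (d : nat) (disp : measure_display) (X : measurableType disp)
    (P : probability X R) (T : X -> X) (f : X -> 'M[R]_d),
    measure_preserving P T ->
    mx_measurable f -> mx_bounded f -> (forall x, in_U (f x)) ->
    exists fstar : X -> 'M[R]_d,
      mx_measurable fstar /\ mx_bounded fstar /\ (forall x, in_U (fstar x)) /\
      {ae P, forall x, (fun n : nat => theta (n%:R^-1) (cocycle f T n x)) @ \oo --> fstar x} /\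
      {ae P, forall x, fstar (T x) = fstar x} /\
      (ergodic P T ->
       {ae P, forall x, forall i j : 'I_d, (i <= j)%N ->
          fstar x i j = lambda (j - i)%N *
            \prod_(i <= k < j) Rintegral P setT (fun y => mxnat (f y) k k.+1)}).
Proof.
exists (fun k => k`!%:R^-1); split=> [k|d disp X P T f mpT mf [M fM] fU].
  by rewrite invr_gt0 ltr0n fact_gt0.
pose phi k y := mxnat (f y) k k.+1.
have phiM k y : `|phi k y| <= `|M| by exact: norm_mxnat_le.
have bphi k : bounded_measurable (phi k).
  by split; [exact: measurable_mxnat | exists `|M|].
pose F k := birkhoff_limsup T (phi k).
have bF k : bounded_measurable (F k) := bounded_measurable_birkhoff_limsup mpT (bphi k).
exists (fun x => exp_superdiag d (F ^~ x)).
split; first by apply: measurable_exp_superdiag => k; have [] := bF k.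
split.
  exists ((1 + `|M|) ^+ d) => x i j.
  by apply: norm_exp_superdiag_le => k; exact: norm_birkhoff_limsup_le.
split; first by move=> x; exact: in_U_exp_superdiag.
split.
  have : {ae P, forall x, forall k, birkhoff_mean T (phi k) x @ \oo --> F k x}.
    by apply/ae_foralln => k; exact: cvg_birkhoff_mean.
  apply: filterS => x phi_cvg; under eq_fun do rewrite cocycle_left_prod.
  exact: cvg_theta_left_prod (fun n => fU _) (fun n => fM _) (fun k _ => phi_cvg k).
split.
  by apply: aeW => x; congr exp_superdiag; apply/funext => k; exact: birkhoff_limsup_invariant.
move=> ergT; have : {ae P, forall x, forall k, F k x = \int[P]_y phi k y}.
  by apply/ae_foralln => k; exact: ergodic_birkhoff_limsup.
by apply: filterS => x phi_int i j ij; rewrite mxE ij; under eq_bigr do rewrite phi_int.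
Qed.
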